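(* Let $d\ge1$ and let $\Phi$ be a Young function such that the limits $\lim_{t\to0^+}\frac{t\Phi'(t)}{\Phi(t)}$ and $\lim_{t\to\infty}\frac{t\Phi'(t)}{\Phi(t)}$ exist. If $1<q_{[\Phi]}\le p_{[\Phi]}<\infty$, then $$L^p(\mathbb R^d)\cap L^q(\mathbb R^d)\subseteq L^\Phi(\mathbb R^d)\subseteq L^p(\mathbb R^d)+L^q(\mathbb R^d)$$ for all $p\in(p_{[\Phi]},\infty)$ and $q\in(1,q_{[\Phi]})$.
   Context: A Young function is a convex function $\Phi:[0,\infty)\to[0,\infty)$ with $\Phi(0)=0$, $\Phi(t)>0$ for $t>0$, and $\lim_{t\to\infty}\Phi(t)=\infty$. $\Phi'$ denotes the right derivative of $\Phi$. The Lebesgue exponents of $\Phi$ are $p_\Phi=\sup_{t>0}\frac{t\Phi'(t)}{\Phi(t)}$ and $q_\Phi=\inf_{t>0}\frac{t\Phi'(t)}{\Phi(t)}$. Two Young functions $\Phi,\Psi$ are equivalent if there is $C\ge1$ with $C^{-1}\Psi(t)\le\Phi(t)\le C\Psi(t)$ for all $t\ge0$; $[\Phi]$ denotes the set of Young functions equivalent to $\Phi$, and $p_{[\Phi]}=\inf\{p_\Psi:\Psi\in[\Phi]\}$, $q_{[\Phi]}=\sup\{q_\Psi:\Psi\in[\Phi]\}$. For a measurable $f$ on $\mathbb R^d$, $\rho_\Phi(f)=\int_{\mathbb R^d}\Phi(|f(x)|)\,dx$, the Luxemburg norm is $\|f\|_{L^\Phi}=\inf\{\lambda>0:\rho_\Phi(f/\lambda)\le1\}$,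 and the Orlicz space $L^\Phi(\mathbb R^d)$ consists of (classes of) measurable $f$ with $\|f\|_{L^\Phi}<\infty$. $L^p+L^q$ is the set of sums $g+h$ with $g\in L^p$, $h\in L^q$. *)

(* Defs.v *)
From HB Require Import structures.
From mathcomp Require Import all_boot all_order all_algebra.
From mathcomp Require Import all_classical all_reals all_analysis.
Set Implicit Arguments. Unset Strict Implicit. Unset Printing Implicit Defensive.
Import Order.TTheory GRing.Theory Num.Theory.
Import numFieldNormedType.Exports.
Local Open Scope classical_set_scope.
Local Open Scope ring_scope.

(* Sigma-finiteness of the product of two sigma-finite measures (the library
   proves it but its instance is shadowed by another canonical instance). *)
Section prodsf.
Local Open Scope ereal_scope.
Context d1 d2 (T1 : measurableType d1) (T2 : measurableType d2) (R : realType).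
Variable m1 : {sigma_finite_measure set T1 -> \bar R}.
Variable m2 : {sigma_finite_measure set T2 -> \bar R}.

Lemma product_measure1_sigma_finite : sigma_finite setT (m1 \x m2).
Proof.
have /sigma_finiteP[F [TF ndF Foo]] := sigma_finiteT m1.
have /sigma_finiteP[G [TG ndG Goo]] := sigma_finiteT m2.
exists (fun n => F n `*` G n).
  rewrite -setXTT TF TG predeqE => -[x y]; split.
    move=> [/= [n _ Fnx] [k _ Gky]]; exists (maxn n k) => //; split.
    - by move: x Fnx; exact/subsetPset/ndF/leq_maxl.
    - by move: y Gky; exact/subsetPset/ndG/leq_maxr.
  by move=> [n _ []/= ? ?]; split; exists n.
move=> k; have [? ?] := Foo k; have [? ?] := Goo k.
split; first exact: measurableX.
by rewrite product_measure1E// lte_mul_pinfty// ge0_fin_numE.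
Qed.

Definition sf_prod : {sigma_finite_measure set (T1 * T2)%type -> \bar R} :=
  HB.pack (m1 \x m2)%E
    (Measure_isSigmaFinite.Build _ _ _ (m1 \x m2)%E product_measure1_sigma_finite).
End prodsf.

Record mspace (R : realType) := MSpace {
  ms_disp : measure_display;
  ms_type : measurableType ms_disp;
  ms_meas : {sigma_finite_measure set ms_type -> \bar R} }.

(* lebRd R n = (R^(n+1), Borel sets, Lebesgue measure), built as the
   iterated product R * (R * ( ... * R)) of the Lebesgue measure on R. *)
Fixpoint lebRd (R : realType) (n : nat) : mspace R :=
  match n with
  | 0 => @MSpace R _ (measurableTypeR R) (@lebesgue_measure R)
  | n'.+1 => let S := lebRd R n' in
      @MSpace R _ (measurableTypeR R * ms_type S)%type
        (sf_prod (@lebesgue_measure R) (ms_meas S))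
  end.

Definition Rd (R : realType) (d : nat) : Type := ms_type (lebRd R d.-1).
Definition lebd (R : realType) (d : nat) : set (Rd R d) -> \bar R :=
  ms_meas (lebRd R d.-1).

Definition young_function (R : realType) (Phi : R -> R) : Prop :=
  [/\ (forall x y l : R, 0 <= x -> 0 <= y -> 0 <= l <= 1 ->
         Phi (l * x + (1 - l) * y) <= l * Phi x + (1 - l) * Phi y),
      (forall t : R, 0 <= t -> 0 <= Phi t),
      Phi 0 = 0,
      (forall t : R, 0 < t -> 0 < Phi t) &
      Phi t @[t --> +oo] --> +oo].

Definition rderiv (R : realType) (Phi : R -> R) (t : R) : R :=
  lim ((Phi (t + h) - Phi t) / h @[h --> 0^'+]).

Definition young_ratio (R : realType) (Phi : R -> R) (t : R) : R :=
  t * rderiv Phi t / Phi t.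

Definition p_exp (R : realType) (Phi : R -> R) : \bar R :=
  ereal_sup [set (young_ratio Phi t)%:E | t in [set t : R | 0 < t]].
Definition q_exp (R : realType) (Phi : R -> R) : \bar R :=
  ereal_inf [set (young_ratio Phi t)%:E | t in [set t : R | 0 < t]].

Definition young_equiv (R : realType) (Phi Psi : R -> R) : Prop :=
  exists C : R, 1 <= C /\
    forall t : R, 0 <= t -> C^-1 * Psi t <= Phi t /\ Phi t <= C * Psi t.

Definition young_class (R : realType) (Phi : R -> R) : set (R -> R) :=
  [set Psi | young_function Psi /\ young_equiv Phi Psi].

Definition p_class (R : realType) (Phi : R -> R) : \bar R :=
  ereal_inf [set p_exp Psi | Psi in young_class Phi].
Definition q_class (R : realType) (Phi : R -> R) : \bar R :=
  ereal_sup [set q_exp Psi | Psi in young_class Phi].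

Section spaces.
Context (R : realType) (disp : measure_display) (T : measurableType disp).
Variable mu : set T -> \bar R.

Definition modular (Phi : R -> R) (f : T -> R) : \bar R :=
  (\int[mu]_x (Phi `|f x|)%:E)%E.

Definition luxemburg_norm (Phi : R -> R) (f : T -> R) : \bar R :=
  ereal_inf [set lam%:E | lam in
    [set lam : R | 0 < lam /\ (modular Phi (fun x => (f x / lam)%R) <= 1)%E]].

Definition orlicz_space (Phi : R -> R) : set (T -> R) :=
  [set f : T -> R | measurable_fun setT f /\ (luxemburg_norm Phi f < +oo)%E].

Definition Lp_space (p : R) : set (T -> R) :=
  [set f : T -> R | measurable_fun setT f /\ (\int[mu]_x (`|f x| `^ p)%:E < +oo)%E].

(* L^p + L^q (equality of functions up to a mu-null set, as classes) *)
Definition Lp_sum (p q : R) : set (T -> R) :=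
  [set f : T -> R | exists g h, Lp_space p g /\ Lp_space q h /\
     {ae mu, forall x, f x = g x + h x}].
End spaces.

(* Main.v *)
Require Import Defs.
From HB Require Import structures.
From mathcomp Require Import all_boot all_order all_algebra.
From mathcomp Require Import all_classical all_reals all_analysis.
From mathcomp Require Import ring lra measurable_realfun.
Import Order.TTheory GRing.Theory Num.Theory.
Import numFieldNormedType.Exports.
Local Open Scope classical_set_scope.
Local Open Scope ring_scope.

(* If t Psi'(t)/Psi(t) <= P for a Young function Psi, convexity bounds the chords of Psi
   by its right derivative, which gives
     Psi(y)/y^P * (1 - P^2 (y/x - 1)^2) <= Psi(x)/x^P   for 0 < x < y.
   Along n geometric steps from x to y these defects multiply to 1 - O(1/n), so
   Psi(t)/t^P is nonincreasing; likewise t Psi'/Psi >= Q makes Psi(t)/t^Q nondecreasing.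
   Picking Psi in [Phi] with p_Psi < p, resp. q < q_Psi, yields t^p <~ Phi(t) <~ t^q on
   [0,1] and t^q <~ Phi(t) <~ t^p on [1,oo).  Thus Phi(t) <~ t^p + t^q, which gives the
   first inclusion, and f with rho_Phi(f/lam) <= 1 splits into f 1_{|f| <= lam} in L^p
   and f 1_{|f| > lam} in L^q. *)

Set Implicit Arguments. Unset Strict Implicit. Unset Printing Implicit Defensive.

Section convex_slopes.
Context (R : realType) (Phi : R -> R).
Hypothesis Phi_convex : forall x y l : R, 0 <= x -> 0 <= y -> 0 <= l <= 1 ->
  Phi (l * x + (1 - l) * y) <= l * Phi x + (1 - l) * Phi y.

Lemma convex_slope_le s t u : 0 <= s -> s < t -> t < u ->
  (Phi t - Phi s) * (u - t) <= (Phi u - Phi t) * (t - s).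
Proof.
move=> s0 st tu; have us : 0 < u - s by lra.
set l := (u - t) / (u - s).
have l01 : 0 <= l <= 1 by rewrite divr_ge0 ?ler_pdivrMr //=; lra.
have ut : u - t = l * (u - s) by rewrite mulfVK //; lra.
have ts : t - s = (1 - l) * (u - s) by rewrite mulrBl mul1r -ut; lra.
have lt : l * s + (1 - l) * u = t by rewrite -[t](subrK s) ts; ring.
have u0 : 0 <= u by lra.
have := Phi_convex s0 u0 l01; rewrite lt -subr_ge0 => cvx.
rewrite -subr_ge0 ut ts (_ : _ - _ = (u - s) * (l * Phi s + (1 - l) * Phi u - Phi t)).
  by rewrite mulr_ge0 // ltW.
ring.
Qed.

Let slope t h := (Phi (t + h) - Phi t) / h.

Lemma slope_nondecreasing t h1 h2 : 0 <= t -> 0 < h1 -> h1 <= h2 ->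
  slope t h1 <= slope t h2.
Proof.
move=> t0 h10; rewrite le_eqVlt => /orP[/eqP<-//|h12].
have h20 : 0 < h2 by lra.
rewrite /slope ler_pdivrMr // mulrAC ler_pdivlMr //.
have th1 : t < t + h1 by lra.
have h1h2 : t + h1 < t + h2 by lra.
have := convex_slope_le t0 th1 h1h2.
have -> : t + h2 - (t + h1) = h2 - h1 by ring.
have -> : t + h1 - t = h1 by ring.
lra.
Qed.

Lemma chord_le_slope s t h : 0 <= s -> s < t -> 0 < h ->
  (Phi t - Phi s) / (t - s) <= slope t h.
Proof.
move=> s0 st h0; rewrite /slope ler_pdivrMr; last lra.
rewrite mulrAC ler_pdivlMr //.
have th : t < t + h by lra.
have := convex_slope_le s0 st th; rewrite (_ : t + h - t = h); [lra|ring].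
Qed.

Lemma rderiv_cvg t : 0 < t -> cvg (slope t h @[h --> 0^'+]).
Proof.
move=> t0; apply: nondecreasing_at_right_is_cvgr.
  near=> x => h1 h2; rewrite !in_itv /= => /andP[h10 _] /andP[h20 _] h12.
  exact: slope_nondecreasing (ltW t0) h10 h12.
near=> x; exists ((Phi t - Phi 0) / (t - 0)) => y [h] /=.
by rewrite in_itv /= => /andP[h0 _] <-; exact: chord_le_slope.
Unshelve. all: by end_near. Qed.

Lemma chord_le_rderiv s t : 0 <= s -> s < t ->
  (Phi t - Phi s) / (t - s) <= rderiv Phi t.
Proof.
move=> s0 st; apply: limr_ge; first exact/rderiv_cvg/(le_lt_trans s0 st).
near=> h; apply: chord_le_slope => //; near: h; exact: nbhs_right_gt.
Unshelve. all: by end_near. Qed.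

Lemma rderiv_le_chord t u : 0 < t -> t < u ->
  rderiv Phi t <= (Phi u - Phi t) / (u - t).
Proof.
move=> t0 tu; rewrite {1}(_ : u = t + (u - t)); last by ring.
apply: limr_le; first exact: rderiv_cvg.
near=> h; apply: slope_nondecreasing (ltW t0) _ _.
  by near: h; exact: nbhs_right_gt.
by apply: ltW; near: h; apply: nbhs_right_lt; lra.
Unshelve. all: by end_near. Qed.

End convex_slopes.

Lemma bernoulli_ineq (R : realDomainType) (x : R) n :
  -1 <= x -> 1 + n%:R * x <= (1 + x) ^+ n.
Proof.
move=> x1; elim: n => [|n IH]; first by rewrite mul0r addr0 expr0.
have n0 : 0 <= n%:R :> R by [].
have : 0 <= (1 + x) * ((1 + x) ^+ n - (1 + n%:R * x)) by rewrite mulr_ge0 // ?subr_ge0; lra.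
have : 0 <= n%:R * x ^+ 2 by rewrite mulr_ge0 // sqr_ge0.
rewrite [in X in _ -> _ -> X]exprS -natr1; nra.
Qed.

Section quadratic_defect.
Context (R : realType) (H : R -> R) (K : R).
Hypotheses (K_ge0 : 0 <= K) (H_ge0 : forall x, 0 < x -> 0 <= H x).
Hypothesis H_defect : forall x y, 0 < x -> x < y ->
  H y * (1 - K * (y / x - 1) ^+ 2) <= H x.

Lemma defect_geometric_chain x r k : 0 < x -> 1 < r -> K * (r - 1) ^+ 2 <= 1 ->
  H (x * r ^+ k) * (1 - K * (r - 1) ^+ 2) ^+ k <= H x.
Proof.
move=> x0 r1; set e := K * (r - 1) ^+ 2 => e1.
elim: k => [|k IH]; first by rewrite !expr0 !mulr1.
have xk0 : 0 < x * r ^+ k by rewrite mulr_gt0 // exprn_gt0 //; lra.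
have xkS : x * r ^+ k < x * r ^+ k.+1 by rewrite exprS mulrCA ltr_pMl.
have := H_defect xk0 xkS.
rewrite (_ : x * r ^+ k.+1 / (x * r ^+ k) - 1 = r - 1) => [step|]; last first.
  by rewrite exprS mulrCA mulfK ?gt_eqF.
apply: le_trans IH.
have -> : H (x * r ^+ k.+1) * (1 - e) ^+ k.+1 = H (x * r ^+ k.+1) * (1 - e) * (1 - e) ^+ k.
  by rewrite [RHS]mulrAC -mulrA -exprSr.
by apply: ler_wpM2r => //; rewrite exprn_ge0 // subr_ge0.
Qed.

Lemma defect_geometric_le x y n : 0 < x -> x < y -> (0 < n)%N ->
  H y * (1 - K * (y / x - 1) ^+ 2 / n%:R) <= H x.
Proof.
move=> x0 xy n0; have y0 : 0 < y by lra.
have nR0 : n%:R != 0 :> R by rewrite pnatr_eq0 -lt0n.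
have yx1 : 1 < y / x by rewrite ltr_pdivlMr // mul1r.
set w := y / x - 1; set r := (y / x) `^ n%:R^-1.
have w0 : 0 < w by rewrite /w subr_gt0.
have rn : r ^+ n = y / x.
  by rewrite -powR_mulrn ?powR_ge0 // -powRrM mulVf ?powRr1 //; lra.
have r0 : 0 <= r by exact: powR_ge0.
have r1 : 1 < r by rewrite -(expr_gt1 n0 r0) rn.
have wn : 0 <= w / n%:R by rewrite divr_ge0 // ltW.
have rw : r - 1 <= w / n%:R.
  suff : r ^+ n <= (1 + w / n%:R) ^+ n by rewrite ler_pXn2r ?nnegrE //; lra.
  rewrite rn; apply: le_trans (bernoulli_ineq _ _); last lra.
  by rewrite [n%:R * _]mulrC divfK // /w; lra.
set e := K * (r - 1) ^+ 2.
have ne : n%:R * e <= K * w ^+ 2 / n%:R.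
  have : (r - 1) ^+ 2 <= (w / n%:R) ^+ 2 by rewrite ler_pXn2r ?nnegrE // subr_ge0 ltW.
  move=> /(ler_wpM2l (mulr_ge0 (ler0n _ n) K_ge0)).
  by rewrite /e mulrA expr_div_n (_ : _ * (_ / _) = K * w ^+ 2 / n%:R) //; field.
have [e1|e1] := lerP e 1.
  have := defect_geometric_chain n x0 r1 e1.
  rewrite rn [x * _]mulrC divfK ?gt_eqF // => chain.
  apply: le_trans chain; apply: ler_wpM2l; first exact: H_ge0.
  have := @bernoulli_ineq _ (- e) n; lra.
apply: le_trans (H_ge0 x0); rewrite mulr_ge0_le0 ?H_ge0 // subr_le0.
have : e <= n%:R * e by rewrite ler_peMl ?ler1n //; lra.
lra.
Qed.

Lemma nonincreasing_of_quadratic_defect x y : 0 < x -> x <= y -> H y <= H x.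
Proof.
move=> x0; rewrite le_eqVlt => /orP[/eqP->//|xy].
apply/ler_addgt0Pr => eps eps0.
set c := H y * K * (y / x - 1) ^+ 2.
have c0 : 0 <= c by rewrite mulr_ge0 ?sqr_ge0 ?mulr_ge0 ?H_ge0 //; lra.
set n := (Num.truncn (c / eps)).+1.
have n0 : 0 < n%:R :> R by rewrite ltr0n.
have : c / n%:R <= eps.
  rewrite ler_pdivrMr // mulrC -ler_pdivrMr //; exact/ltW/truncnS_gt.
have := @defect_geometric_le x y n x0 xy (ltn0Sn _).
rewrite (_ : _ * (1 - _) = H y - c / n%:R); [lra | rewrite /c; ring].
Qed.

End quadratic_defect.

Lemma mulr_1Bsqr_le (R : realDomainType) (X Y a u c : R) :
  0 <= X -> 0 <= Y -> 0 <= a -> u ^+ 2 <= c ^+ 2 ->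
  X * (1 - u) <= Y -> 1 + u <= a -> X * (1 - c ^+ 2) <= Y * a.
Proof.
move=> X0 Y0 a0 uc hX ha; apply: le_trans (_ : X * (1 - u ^+ 2) <= _).
  by rewrite ler_wpM2l // lerB.
have [u1|u1] := lerP 0 (1 + u).
  rewrite (_ : 1 - u ^+ 2 = (1 - u) * (1 + u)); last by rewrite expr2; ring.
  rewrite mulrA; apply: le_trans (ler_wpM2r u1 hX) _; exact: ler_wpM2l.
have : 1 - u ^+ 2 <= 0 by rewrite subr_le0 -sqrrN exprn_ege1 //; lra.
by move=> /(mulr_ge0_le0 X0) /le_trans; apply; rewrite mulr_ge0.
Qed.

Lemma affine_le_powR (R : realType) (z P : R) :
  0 < z -> 0 <= P -> 1 + P * (1 - z^-1) <= z `^ P.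
Proof.
move=> z0 P0; rewrite /powR gt_eqF //; apply: le_trans (expR_ge1Dx _).
rewrite lerD2l ler_wpM2l //.
have := expR_ge1Dx (ln z^-1); rewrite lnK ?posrE ?invr_gt0 // lnV ?posrE //; lra.
Qed.

Lemma divpowR_mul_le (R : realType) (X Y s t P c : R) : 0 < s -> 0 < t ->
  X * c <= Y * (t / s) `^ P -> X / t `^ P * c <= Y / s `^ P.
Proof.
move=> s0 t0; have sP := powR_gt0 P s0; have tsP := powR_gt0 P (divr_gt0 t0 s0).
have -> : t `^ P = (t / s) `^ P * s `^ P.
  by rewrite -powRM ?divfK ?gt_eqF ?divr_ge0 ?ltW.
by rewrite mulrAC invfM mulrA ler_pM2r ?invr_gt0 // ler_pdivrMr.
Qed.

Section young_function.
Context (R : realType) (Phi : R -> R).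
Hypothesis Phi_young : young_function Phi.

Lemma young_convex x y l : 0 <= x -> 0 <= y -> 0 <= l <= 1 ->
  Phi (l * x + (1 - l) * y) <= l * Phi x + (1 - l) * Phi y.
Proof. by case: Phi_young => cvx _ _ _ _; exact: cvx. Qed.

Lemma young_ge0 t : 0 <= t -> 0 <= Phi t.
Proof. by case: Phi_young => _ ge0 _ _ _; exact: ge0. Qed.

Lemma young_gt0 t : 0 < t -> 0 < Phi t.
Proof. by case: Phi_young => _ _ _ gt0 _; exact: gt0. Qed.

Lemma young0 : Phi 0 = 0.
Proof. by case: Phi_young. Qed.

Lemma young_nondecreasing x y : 0 <= x -> x <= y -> Phi x <= Phi y.
Proof.
move=> x0; rewrite le_eqVlt => /orP[/eqP->//|xy]; have y0 : 0 < y by lra.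
have l01 : 0 <= x / y <= 1.
  by apply/andP; split; [rewrite divr_ge0 // ltW | rewrite ler_pdivrMr // mul1r ltW].
have := young_convex (ltW y0) (lexx 0) l01.
rewrite mulr0 addr0 young0 mulr0 addr0 divfK ?gt_eqF // => /le_trans; apply.
by apply: ler_piMl; [exact/young_ge0/ltW | case/andP: l01].
Qed.

Lemma young_ratio_le_defect P s t : 0 <= P ->
  (forall t, 0 < t -> young_ratio Phi t <= P) -> 0 < s -> s < t ->
  Phi t / t `^ P * (1 - P ^+ 2 * (t / s - 1) ^+ 2) <= Phi s / s `^ P.
Proof.
move=> P0 ratio s0 st; have t0 : 0 < t by lra.
have ts0 : 0 < t - s by rewrite subr_gt0.
have Pt := young_gt0 t0; have Ps := young_ge0 (ltW s0).
have := chord_le_rderiv young_convex (ltW s0) st.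
have := ratio _ t0; rewrite /young_ratio ler_pdivrMr // mulrC -ler_pdivlMr //.
set r := rderiv Phi t => hr; rewrite ler_pdivrMr // => hd.
set z := P * (1 - s / t).
have hX : Phi t * (1 - z) <= Phi s.
  have := ler_wpM2r (ltW ts0) hr.
  rewrite (_ : Phi t * (1 - z) = Phi t - P * Phi t / t * (t - s)); first lra.
  by rewrite /z; field; rewrite gt_eqF.
have ha : 1 + z <= (t / s) `^ P.
  by have := affine_le_powR (divr_gt0 t0 s0) P0; rewrite invf_div.
have z0 : 0 <= z by rewrite mulr_ge0 // subr_ge0 ler_pdivrMr // mul1r ltW.
have zc : z <= P * (t / s - 1).
  rewrite ler_wpM2l // -subr_ge0 (_ : _ - _ = (t - s) ^+ 2 / (s * t)).
    by rewrite divr_ge0 ?sqr_ge0 ?mulr_ge0 ?ltW.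
  by field; rewrite !gt_eqF.
apply: divpowR_mul_le => //; rewrite -exprMn.
apply: (mulr_1Bsqr_le (ltW Pt) Ps (powR_ge0 _ _) _ hX ha).
by rewrite ler_pXn2r ?nnegrE ?(le_trans z0 zc).
Qed.

Lemma young_ratio_ge_defect Q t u : 0 <= Q ->
  (forall t, 0 < t -> Q <= young_ratio Phi t) -> 0 < t -> t < u ->
  Phi t / t `^ Q * (1 - Q ^+ 2 * (u / t - 1) ^+ 2) <= Phi u / u `^ Q.
Proof.
move=> Q0 ratio t0 tu; have u0 : 0 < u by lra.
have ut0 : 0 < u - t by rewrite subr_gt0.
have Pt := young_gt0 t0; have Pu := young_ge0 (ltW u0).
have := rderiv_le_chord young_convex t0 tu.
have := ratio _ t0; rewrite /young_ratio ler_pdivlMr // (mulrC t) -ler_pdivrMr //.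
set r := rderiv Phi t => hr; rewrite ler_pdivlMr // => hd.
set z := Q * (u / t - 1).
have hX : Phi t * (1 - - z) <= Phi u.
  have := ler_wpM2r (ltW ut0) hr.
  rewrite (_ : Phi t * (1 - - z) = Phi t + Q * Phi t / t * (u - t)); first lra.
  by rewrite /z; field; rewrite gt_eqF.
have hb : 1 + - z <= (t / u) `^ Q.
  rewrite (_ : 1 + - z = 1 + Q * (1 - (t / u)^-1)); last by rewrite invf_div /z; ring.
  exact: affine_le_powR (divr_gt0 t0 u0) Q0.
apply: divpowR_mul_le => //; rewrite -exprMn.
by apply: (mulr_1Bsqr_le (ltW Pt) Pu (powR_ge0 _ _) _ hX hb); rewrite sqrrN.
Qed.

Lemma ratio_le_divpowR_nonincreasing P x y : 0 <= P ->
  (forall t, 0 < t -> young_ratio Phi t <= P) -> 0 < x -> x <= y ->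
  Phi y / y `^ P <= Phi x / x `^ P.
Proof.
move=> P0 ratio.
apply: (@nonincreasing_of_quadratic_defect _ (fun t => Phi t / t `^ P) (P ^+ 2)) => //.
- exact: exprn_ge0.
- by move=> t t0; rewrite divr_ge0 ?powR_ge0 ?young_ge0 ?ltW.
- by move=> s t s0 st; exact: young_ratio_le_defect.
Qed.

Lemma ratio_ge_divpowR_nondecreasing Q x y : 0 <= Q ->
  (forall t, 0 < t -> Q <= young_ratio Phi t) -> 0 < x -> x <= y ->
  Phi x / x `^ Q <= Phi y / y `^ Q.
Proof.
move=> Q0 ratio x0 xy; have y0 : 0 < y by lra.
have pos t : 0 < t -> 0 < Phi t / t `^ Q.
  by move=> t0; rewrite divr_gt0 ?powR_gt0 ?young_gt0.
rewrite -lef_pV2 ?posrE ?pos // !invf_div.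
apply: (@nonincreasing_of_quadratic_defect _ (fun t => t `^ Q / Phi t) (Q ^+ 2)) => //.
- exact: exprn_ge0.
- by move=> t t0; rewrite divr_ge0 ?powR_ge0 ?young_ge0 ?ltW.
move=> s t s0 st /=; have t0 : 0 < t by lra.
rewrite -[t `^ Q / _]invf_div -[s `^ Q / _]invf_div.
set A := Phi s / s `^ Q; set B := Phi t / t `^ Q.
have A0 : 0 < A by exact: pos.
have B0 : 0 < B by exact: pos.
rewrite mulrC ler_pdivrMr // -[A^-1 * B]mulrC ler_pdivlMr // mulrC.
exact: young_ratio_ge_defect.
Qed.

End young_function.

Section young_class.
Context (R : realType) (Phi : R -> R).

Lemma young_equiv_bounds Psi : young_equiv Phi Psi ->
  exists2 C, 0 < C & forall t, 0 <= t -> Phi t <= C * Psi t /\ Psi t <= C * Phi t.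
Proof.
move=> [C [C1 hC]]; have C0 : 0 < C by lra.
exists C => // t t0; have [Psi_le Phi_le] := hC t t0.
by split => //; rewrite -ler_pdivrMl.
Qed.

Lemma p_class_lt_ratio p : (p_class Phi < p%:E)%E -> exists Psi,
  [/\ young_function Psi, young_equiv Phi Psi &
      forall t, 0 < t -> young_ratio Psi t <= p].
Proof.
move=> /ereal_inf_lt[_ [Psi [Psi_young equiv] <-] Psi_p].
exists Psi; split => // t t0; rewrite -lee_fin; apply: le_trans (ltW Psi_p).
by apply: ereal_sup_ubound; exists t.
Qed.

Lemma q_class_gt_ratio q : (q%:E < q_class Phi)%E -> exists Psi,
  [/\ young_function Psi, young_equiv Phi Psi &
      forall t, 0 < t -> q <= young_ratio Psi t].
Proof.
move=> /ereal_sup_gt[_ [Psi [Psi_young equiv] <-] q_Psi].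
exists Psi; split => // t t0; rewrite -lee_fin; apply: le_trans (ltW q_Psi) _.
by apply: ereal_inf_lbound; exists t.
Qed.

Hypothesis Phi_young : young_function Phi.

Lemma young_equiv_powR_transfer Psi e :
  young_function Psi -> young_equiv Phi Psi ->
  exists2 c, 0 < c & forall t, 0 < t ->
    (Psi t <= Psi 1 * t `^ e -> Phi t <= c * t `^ e) /\
    (Psi 1 * t `^ e <= Psi t -> t `^ e <= c * Phi t).
Proof.
move=> Psi_young /young_equiv_bounds[C C0 hC].
have Psi1 : 0 < Psi 1 := young_gt0 Psi_young ltr01.
exists (C * (Psi 1 + (Psi 1)^-1)); first by rewrite mulr_gt0 ?addr_gt0 ?invr_gt0.
move=> t t0; have te : 0 < t `^ e by rewrite powR_gt0.
have [Phi_le Psi_le] := hC t (ltW t0); split=> Psi_t.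
  apply: le_trans Phi_le _; rewrite -mulrA ler_pM2l //.
  by apply: le_trans Psi_t _; rewrite ler_pM2r // lerDl invr_ge0 ltW.
have := le_trans Psi_t Psi_le; rewrite -ler_pdivlMl // => /le_trans; apply.
rewrite mulrCA -mulrA ler_pM2l // ler_pM2r ?(young_gt0 Phi_young) //.
by rewrite lerDr ltW.
Qed.

Lemma p_class_powR_bounds p : 0 < p -> (p_class Phi < p%:E)%E ->
  exists2 c, 0 < c & (forall t, 1 <= t -> Phi t <= c * t `^ p) /\
                     (forall t, 0 <= t <= 1 -> t `^ p <= c * Phi t).
Proof.
move=> p0 /p_class_lt_ratio[Psi [Psi_young equiv ratio]].
have mono := ratio_le_divpowR_nonincreasing Psi_young (ltW p0) ratio.
have [c c0 transfer] := young_equiv_powR_transfer p Psi_young equiv.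
exists c => //; split=> [t t1 | t /andP[t0 t1]].
  have t_pos : 0 < t by lra.
  apply: (proj1 (transfer t t_pos)).
  by have := mono 1 t ltr01 t1; rewrite powR1 divr1 ler_pdivrMr ?powR_gt0.
have [->|t_neq0] := eqVneq t 0.
  by rewrite powR0 ?gt_eqF // (young0 Phi_young) mulr0.
have t_pos : 0 < t by rewrite lt0r t_neq0.
apply: (proj2 (transfer t t_pos)).
by have := mono t 1 t_pos t1; rewrite powR1 divr1 ler_pdivlMr ?powR_gt0.
Qed.

Lemma q_class_powR_bounds q : 0 <= q -> (q%:E < q_class Phi)%E ->
  exists2 c, 0 < c & (forall t, 0 <= t <= 1 -> Phi t <= c * t `^ q) /\
                     (forall t, 1 <= t -> t `^ q <= c * Phi t).
Proof.
move=> q0 /q_class_gt_ratio[Psi [Psi_young equiv ratio]].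
have mono := ratio_ge_divpowR_nondecreasing Psi_young q0 ratio.
have [c c0 transfer] := young_equiv_powR_transfer q Psi_young equiv.
exists c => //; split=> [t /andP[t0 t1] | t t1].
  have [->|t_neq0] := eqVneq t 0.
    by rewrite (young0 Phi_young) mulr_ge0 ?powR_ge0 ?ltW.
  have t_pos : 0 < t by rewrite lt0r t_neq0.
  apply: (proj1 (transfer t t_pos)).
  by have := mono t 1 t_pos t1; rewrite powR1 divr1 ler_pdivrMr ?powR_gt0.
have t_pos : 0 < t by lra.
apply: (proj2 (transfer t t_pos)).
by have := mono 1 t ltr01 t1; rewrite powR1 divr1 ler_pdivlMr ?powR_gt0.
Qed.

End young_class.

Lemma powR_div_le (R : realType) (z l r : R) : 0 <= z -> 1 <= l -> 1 <= r ->
  (z / l) `^ r <= z `^ r / l.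
Proof.
move=> z0 l1 r1; have l0 : 0 < l by lra.
have -> : z `^ r = (z / l) `^ r * l `^ r.
  by rewrite -powRM ?divr_ge0 ?(ltW l0) // divfK // gt_eqF.
by rewrite ler_pdivlMr //; apply/ler_wpM2l/le1r_powR; rewrite ?powR_ge0.
Qed.

Lemma powR_sum_bound (R : realType) (Phi : R -> R) p q cp cq :
  0 <= cp -> 0 <= cq ->
  (forall t, 1 <= t -> Phi t <= cp * t `^ p) ->
  (forall t, 0 <= t <= 1 -> Phi t <= cq * t `^ q) ->
  forall t, 0 <= t -> Phi t <= (cp + cq) * (t `^ p + t `^ q).
Proof.
move=> cp0 cq0 Phi_p Phi_q t t0; have tp := powR_ge0 t p; have tq := powR_ge0 t q.
have := mulr_ge0 cp0 tq; have := mulr_ge0 cq0 tp.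
have [t1|t1] := lerP 1 t; first by have := Phi_p t t1; nra.
by have := Phi_q t (_ : 0 <= t <= 1); rewrite t0 ltW //=; nra.
Qed.

Section Lp_spaces.
Context (R : realType) (d : measure_display) (T : measurableType d).
Variable mu : {measure set T -> \bar R}.

Lemma measurable_powR_norm (g : T -> R) (p : R) : measurable_fun setT g ->
  measurable_fun setT (fun x => (`|g x| `^ p)%:E).
Proof.
move=> mg; apply/measurable_EFinP.
exact: measurableT_comp (measurable_powR p) (measurableT_comp (@normr_measurable R setT) mg).
Qed.

Lemma Lp_space_of_le (g F : T -> R) (p c : R) : measurable_fun setT g ->
  measurable_fun setT (fun x => (F x)%:E) -> (forall x, 0 <= F x) -> 0 <= c ->
  (forall x, `|g x| `^ p <= c * F x) -> (\int[mu]_x (F x)%:E <= 1)%E ->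
  Lp_space mu p g.
Proof.
move=> mg mF F0 c0 g_le F_le1; split => //.
apply: (@le_lt_trans _ _ (c%:E * \int[mu]_x (F x)%:E)%E).
  rewrite -ge0_integralZl //; last by move=> x _; rewrite lee_fin.
  apply: ge0_le_integral.
  - exact: measurableT.
  - by move=> x _; rewrite lee_fin powR_ge0.
  - exact: measurable_powR_norm.
  - under eq_fun do rewrite -EFinM.
    by apply/measurable_EFinP/measurable_funM => //; exact/measurable_EFinP.
  - by move=> x _; rewrite -EFinM lee_fin.
by apply: (@le_lt_trans _ _ c%:E); [rewrite -[leRHS]mule1 lee_wpmul2l | exact: ltry].
Qed.

End Lp_spaces.

Section orlicz_inclusions.
Context (R : realType) (d : measure_display) (T : measurableType d).
Variable mu : {measure set T -> \bar R}.
Variable Phi : R -> R.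
Hypothesis Phi_young : young_function Phi.

Lemma measurable_young_norm (g : T -> R) : measurable_fun setT g ->
  measurable_fun setT (fun x => (Phi `|g x|)%:E).
Proof.
move=> mg; apply/measurable_EFinP.
have -> : (fun x => Phi `|g x|) = (fun z => Phi (Num.max z 0)) \o (fun z => `|z|) \o g.
  by apply: funext => x /=; rewrite max_l.
apply: measurableT_comp mg; apply: measurableT_comp (@normr_measurable R setT).
apply: nondecreasing_measurable => // x y xy.
by apply: (young_nondecreasing Phi_young); rewrite ?ge_max !le_max ?xy ?lexx !orbT.
Qed.

Lemma modular_div_le (f : T -> R) (p q A lam : R) : measurable_fun setT f ->
  1 <= p -> 1 <= q -> 0 <= A -> 1 <= lam ->
  (forall t, 0 <= t -> Phi t <= A * (t `^ p + t `^ q)) ->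
  (modular mu Phi (fun x => (f x / lam)%R) <=
   (A / lam)%R%:E * (\int[mu]_x (`|f x| `^ p)%:E + \int[mu]_x (`|f x| `^ q)%:E))%E.
Proof.
move=> mf p1 q1 A0 lam1 Phi_le; have lam0 : 0 < lam by lra.
have mp r : measurable_fun setT (fun x => (`|f x| `^ r)%:E).
  exact: measurable_powR_norm.
rewrite -ge0_integralD // -ge0_integralZl //; last 3 first.
- exact: emeasurable_funD (mp p) (mp q).
- by move=> x _; rewrite adde_ge0 // lee_fin powR_ge0.
- by rewrite lee_fin divr_ge0 // ltW.
apply: ge0_le_integral.
- exact: measurableT.
- by move=> x _; rewrite lee_fin young_ge0.
- exact/measurable_young_norm/measurable_funM.
- under eq_fun do rewrite -EFinD -EFinM.
  apply/measurable_EFinP/measurable_funM => //.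
  by apply: measurable_funD; apply/measurable_EFinP; exact: mp.
move=> x _; rewrite -EFinD -EFinM lee_fin normrM normfV (gtr0_norm lam0).
apply: le_trans (Phi_le _ (divr_ge0 (normr_ge0 _) (ltW lam0))) _.
rewrite -mulrA ler_wpM2l // mulrDr !(mulrC lam^-1).
by apply: lerD; apply: powR_div_le.
Qed.

Lemma Lp_setI_subset_orlicz p q cp cq : 1 <= p -> 1 <= q -> 0 <= cp -> 0 <= cq ->
  (forall t, 1 <= t -> Phi t <= cp * t `^ p) ->
  (forall t, 0 <= t <= 1 -> Phi t <= cq * t `^ q) ->
  Lp_space mu p `&` Lp_space mu q `<=` orlicz_space mu Phi.
Proof.
move=> p1 q1 cp0 cq0 Phi_p Phi_q f [[mf Ip] [_ Iq]]; split => //.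
have J0 r : (0 <= \int[mu]_x (`|f x| `^ r)%:E)%E.
  by apply: integral_ge0 => x _; rewrite lee_fin powR_ge0.
set Jp := (\int[mu]_x (`|f x| `^ p)%:E)%E in Ip *.
set Jq := (\int[mu]_x (`|f x| `^ q)%:E)%E in Iq *.
have Jp_fin : Jp \is a fin_num by rewrite ge0_fin_numE ?J0.
have Jq_fin : Jq \is a fin_num by rewrite ge0_fin_numE ?J0.
set A := cp + cq; have A0 : 0 <= A by rewrite addr_ge0.
set lam := 1 + A * (fine Jp + fine Jq).
have lam1 : 1 <= lam by rewrite lerDl mulr_ge0 ?addr_ge0 ?fine_ge0 ?J0.
have lam0 : 0 < lam by lra.
apply: (@le_lt_trans _ _ lam%:E); last exact: ltry.
apply: ge_ereal_inf; exists lam%:E => //; exists lam; split=> //.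
apply: le_trans (modular_div_le mf p1 q1 A0 lam1 _) _.
  exact: powR_sum_bound.
rewrite -/Jp -/Jq -(fineK Jp_fin) -(fineK Jq_fin) -EFinD -EFinM lee_fin.
by rewrite mulrAC ler_pdivrMr // mul1r /lam; lra.
Qed.

Lemma orlicz_subset_Lp_sum p q cp cq : 0 < p -> 0 < q -> 0 <= cp -> 0 <= cq ->
  (forall t, 0 <= t <= 1 -> t `^ p <= cp * Phi t) ->
  (forall t, 1 <= t -> t `^ q <= cq * Phi t) ->
  orlicz_space mu Phi `<=` Lp_sum mu p q.
Proof.
move=> p0 q0 cp0 cq0 p_Phi q_Phi f [mf /ereal_inf_lt[_ [lam [lam0 mod_le1] <-] _]].
have mF : measurable_fun setT (fun x => (Phi `|f x / lam|)%:E).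
  exact/measurable_young_norm/measurable_funM.
have F0 x : 0 <= Phi `|f x / lam| by rewrite young_ge0.
have norm_f x : `|f x| = `|f x / lam| * lam.
  by rewrite normrM normfV (gtr0_norm lam0) divfK ?gt_eqF.
have pow_f r x : `|f x| `^ r = lam `^ r * `|f x / lam| `^ r.
  by rewrite norm_f (powRM _ (normr_ge0 _) (ltW lam0)) mulrC.
have m_small : measurable_fun setT (fun x => `|f x| <= lam).
  apply: measurable_fun_ler; last exact: measurable_cst.
  exact: measurableT_comp (@normr_measurable R setT) mf.
exists (fun x => if `|f x| <= lam then f x else 0),
       (fun x => if `|f x| <= lam then 0 else f x); split; [|split].
- apply: (@Lp_space_of_le _ _ _ mu _ _ p (lam `^ p * cp) _ mF) => //.
  + by apply: measurable_fun_ifT => //; exact: measurable_cst.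
  + by rewrite mulr_ge0 ?powR_ge0.
  move=> x; case: ifPn => [f_le | _]; last first.
    by rewrite normr0 powR0 ?gt_eqF // !mulr_ge0 ?powR_ge0.
  rewrite pow_f -mulrA ler_wpM2l ?powR_ge0 // p_Phi // normr_ge0.
  by rewrite -(ler_pM2r lam0) -norm_f mul1r.
- apply: (@Lp_space_of_le _ _ _ mu _ _ q (lam `^ q * cq) _ mF) => //.
  + by apply: measurable_fun_ifT => //; exact: measurable_cst.
  + by rewrite mulr_ge0 ?powR_ge0.
  move=> x; case: ifPn => [_ | f_gt].
    by rewrite normr0 powR0 ?gt_eqF // !mulr_ge0 ?powR_ge0.
  rewrite pow_f -mulrA ler_wpM2l ?powR_ge0 // q_Phi //.
  by rewrite -(ler_pM2r lam0) -norm_f mul1r ltW // ltNge.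
- by apply: aeW => x /=; case: ifPn; rewrite ?addr0 ?add0r.
Qed.

End orlicz_inclusions.

Unset Implicit Arguments.

Theorem mainTheorem13 (R : realType) (d : nat) (Phi : R -> R) :
  (1 <= d)%N ->
  young_function Phi ->
  cvg (young_ratio Phi t @[t --> 0^'+]) ->
  cvg (young_ratio Phi t @[t --> +oo]) ->
  (1%:E < q_class Phi)%E ->
  (q_class Phi <= p_class Phi)%E ->
  (p_class Phi < +oo)%E ->
  forall p q : R, (p_class Phi < p%:E)%E -> 1 < q -> (q%:E < q_class Phi)%E ->
    (Lp_space (@lebd R d) p `&` Lp_space (@lebd R d) q
       `<=` orlicz_space (@lebd R d) Phi) /\
    (orlicz_space (@lebd R d) Phi `<=` Lp_sum (@lebd R d) p q).
Proof.
move=> _ Phi_young _ _ _ q_le_p _ p q p_gt q1 q_lt.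
have q_lt_p : q < p.
  by rewrite -lte_fin (lt_le_trans q_lt) // (le_trans q_le_p) // ltW.
have q0 : 0 < q by lra.
have p0 : 0 < p by lra.
have [cp cp0 [Phi_le_p p_le_Phi]] := p_class_powR_bounds Phi_young p0 p_gt.
have [cq cq0 [Phi_le_q q_le_Phi]] := q_class_powR_bounds Phi_young (ltW q0) q_lt.
split.
- apply: (Lp_setI_subset_orlicz Phi_young _ _ (ltW cp0) (ltW cq0) Phi_le_p Phi_le_q); lra.
- exact: (orlicz_subset_Lp_sum Phi_young p0 q0 (ltW cp0) (ltW cq0) p_le_Phi q_le_Phi).
Qed.
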